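(* For coloured token swapping on a star with $n$ vertices, the minimum number of swaps needed to bring every token to a vertex of its own colour is $(n-1-\lambda)+\kappa$, and a swap sequence of this length can be computed in polynomial time.
   Context: Coloured token swapping on a star: a star (tree with one non-leaf vertex $u$, the center) with $n$ vertices; each vertex has a colour and carries one coloured token initially, and for each colour the number of tokens of that colour equals the number of vertices of that colour. A swap exchanges the tokens on the endpoints of an edge; the goal is a configuration where each token lies on a vertex of its own colour. Define the directed multigraph $G$ whose vertices are the colours and which has, for each vertex $v$ of the star with colour $c$ and initial token of colour $d$, a directed edge from $c$ to $d$ labelled $v$ (a loop if $c=d$). A leaf loop is a loop labelled by a leaf of the star; $\lambda$ is the number of leaf loops. A connected component of $G$ is trivial if it has only one vertex; $\kappa$ is the number of non-trivial connected components of $G$ other than the component containing the edge labelled $u$. *)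

(* Defs.v *)
From mathcomp Require Import all_boot all_fingroup.

Set Implicit Arguments.
Unset Strict Implicit.
Unset Printing Implicit Defensive.

Section Graphs.
Variables (V : finType) (e : rel V).

Definition degree (v : V) : nat := #|[set w | e v w]|.

Definition leaf (v : V) : bool := degree v == 1.

(* [:: x; y] is a ucycle for every edge xy, hence the bound 2. *)
Definition acyclic : Prop := forall c : seq V, ucycle e c -> size c <= 2.

Definition tree : Prop :=
  [/\ symmetric e, irreflexive e, (forall x y, connect e x y) & acyclic].

Definition star (u : V) : Prop := tree /\ forall v, ~~ leaf v = (v == u).

End Graphs.

Section Multigraphs.
Variables (C E : finType).

Record mdigraph := MDigraph { source : E -> C; target : E -> C }.

Variable G : mdigraph.

Definition is_loop (x : E) : bool := source G x == target G x.

Definition adjacent : rel C := fun c d =>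
  [exists x, ((source G x == c) && (target G x == d))
          || ((source G x == d) && (target G x == c))].

Definition component (c : C) : {set C} := [set d | connect adjacent c d].

Definition components : {set {set C}} := [set component c | c : C].

Definition nontrivial (S : {set C}) : bool := 1 < #|S|.

End Multigraphs.

Section TokenSwapping.
Variables (V C : finType) (e : rel V).
Variables (col : V -> C) (tok : V -> C).

Definition balanced : Prop :=
  forall c : C, #|[set v | tok v == c]| = #|[set v | col v == c]|.

Definition swap (f : V -> C) (xy : V * V) : V -> C :=
  fun v => f (tperm xy.1 xy.2 v).

Definition solves (s : seq (V * V)) : Prop :=
  all (fun xy => e xy.1 xy.2) s /\ foldl swap tok s =1 col.

Definition min_swaps (m : nat) : Prop :=
  (exists2 s, solves s & size s = m) /\ (forall s, solves s -> m <= size s).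

Definition token_graph : mdigraph C V := MDigraph col tok.

Definition lambda : nat := #|[set v | leaf e v && is_loop token_graph v]|.

Definition kappa (u : V) : nat :=
  #|[set S in components token_graph |
      nontrivial S && (S != component token_graph (col u))]|.

End TokenSwapping.

(* Polynomial time is measured on a unit-cost random access machine with       *)
(* structured control flow: finitely many registers (those named by the        *)
(* program) and an unbounded indirectly addressed memory, all holding natural  *)
(* numbers. Addition and truncated subtraction are the only arithmetic         *)
(* operations, so the bit length of the contents grows by at most a constant   *)
(* (depending on the program) per unit of time, and the model is polynomially  *)
(* equivalent to Turing machines.                                              *)
Inductive expr : Type :=
  | Const of nat
  | Reg of nat
  | Deref of expr
  | Add of expr & expr
  | Sub of expr & expr.

Inductive prog : Type :=
  | Skip
  | Assign of nat & expr
  | Store of expr & expr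
  | Seq of prog & prog
  | If of expr & prog & prog
  | While of expr & prog.

Record state := State { regs : nat -> nat; mem : nat -> nat }.

Fixpoint eval (st : state) (a : expr) : nat :=
  match a with
  | Const k => k
  | Reg r => regs st r
  | Deref b => mem st (eval st b)
  | Add b c => eval st b + eval st c
  | Sub b c => eval st b - eval st c
  end.

Fixpoint expr_cost (a : expr) : nat :=
  match a with
  | Const _ | Reg _ => 1
  | Deref b => (expr_cost b).+1
  | Add b c | Sub b c => (expr_cost b + expr_cost c).+1
  end.

Definition update (f : nat -> nat) (i x : nat) : nat -> nat :=
  fun j => if j == i then x else f j.

(* [exec p st t st']: started in [st], [p] halts in [st'] after time [t].      *)
(* Guards hold when their value is nonzero.                                    *)
Inductive exec : prog -> state -> nat -> state -> Prop :=
  | ExecSkip st : exec Skip st 1 st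
  | ExecAssign st r a :
      exec (Assign r a) st (expr_cost a).+1
           (State (update (regs st) r (eval st a)) (mem st))
  | ExecStore st a b :
      exec (Store a b) st (expr_cost a + expr_cost b).+1
           (State (regs st) (update (mem st) (eval st a) (eval st b)))
  | ExecSeq p q st1 st2 st3 t1 t2 :
      exec p st1 t1 st2 -> exec q st2 t2 st3 ->
      exec (Seq p q) st1 (t1 + t2) st3
  | ExecIfTrue a p q st st' t :
      eval st a != 0 -> exec p st t st' ->
      exec (If a p q) st ((expr_cost a).+1 + t) st'
  | ExecIfFalse a p q st st' t :
      eval st a = 0 -> exec q st t st' ->
      exec (If a p q) st ((expr_cost a).+1 + t) st'
  | ExecWhileTrue a p st1 st2 st3 t1 t2 :
      eval st1 a != 0 -> exec p st1 t1 st2 -> exec (While a p) st2 t2 st3 ->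
      exec (While a p) st1 ((expr_cost a).+1 + t1 + t2) st3
  | ExecWhileFalse a p st :
      eval st a = 0 -> exec (While a p) st (expr_cost a).+1 st.

(* A word is stored with its length in cell 0 and its letters in the next cells. *)
Definition init_state (w : seq nat) : state :=
  State (fun=> 0) (nth 0 (size w :: w)).

Definition holds_word (st : state) (w : seq nat) : Prop :=
  mem st 0 = size w /\ forall i, i < size w -> mem st i.+1 = nth 0 w i.

Definition outputs_within (p : prog) (w out : seq nat) (T : nat) : Prop :=
  exists t st, [/\ exec p (init_state w) t st, t <= T & holds_word st out].

(* A star on vertices 0, ..., n-1 is determined by n and its centre.           *)
Definition encode_instance (n k : nat) (u : 'I_n) (col tok : 'I_n -> 'I_k) :
    seq nat :=
  [:: n; val u] ++ [seq val (col v) | v <- enum 'I_n]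
                ++ [seq val (tok v) | v <- enum 'I_n].

Definition encode_swaps (n : nat) (s : seq ('I_n * 'I_n)) : seq nat :=
  flatten [seq [:: val xy.1; val xy.2] | xy <- s].

(* Main.v *)
Require Import Defs.
From mathcomp Require Import all_boot all_fingroup zify.

(* Let the potential of a configuration be the number of misplaced leaves plus *)
(* the number of non-trivial components avoiding the colour of the centre. A   *)
(* swap of the centre with a leaf v alters only the edges of the centre and of *)
(* v, so it lowers the potential by at most one.                               *)
(*   Conversely, let c be the colour of the centre and d the colour of its     *)
(* token. If no misplaced leaf has colour d, then balance forces c = d and the *)
(* component of c to be trivial, and swapping with any misplaced leaf joins a  *)
(* foreign component to it. Otherwise we swap with a misplaced leaf v of       *)
(* colour d, replacing edges c -> d -> y by c -> y and a loop at d; this is    *)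
(* harmless unless it cuts d off from c. Delete the edge of the centre and all *)
(* edges leaving d: by balance each y is still joined to c or to d. A v whose  *)
(* y is not joined to c is safe, and if there is none then every choice is     *)
(* safe, as any other misplaced leaf of colour d still joins d to c. One       *)
(* quick-find labelling per swap thus suffices to choose v.                    *)

Set Implicit Arguments.
Unset Strict Implicit.
Unset Printing Implicit Defensive.

(** By [star_edge] every swap involves the centre, so [potential_swap_ge] makes the potential a
    lower bound for the length of a solution ([potential_le_size]); [potentialE] identifies it with
    the claimed number. Components are handled through closed sets of colours, and balance enters
    through [balanced_closed]. The bound is attained because swapping with a leaf of largest
    positive [priority] lowers the potential ([potential_swap_greedy]), while all priorities vanish
    only in a solved configuration ([priority0_solved]). The program [star_swapper] repeats this
    choice. Choosing a leaf takes quadratic time and at most 2n swaps occur, so the total time is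
    cubic. Both halves of the theorem follow from [star_swapperP] and the lower bound. *)

(** * The edges of a star *)

(** A leaf has a single neighbour. If the neighbour of a leaf were again a leaf, the two would form
    a closed set missing the centre, against connectedness. *)
Lemma star_edge (V : finType) (e : rel V) (u : V) :
  star e u -> forall x y, e x y = (x != y) && ((x == u) || (y == u)).
Proof.
move=> [[sym irr conn _] leafE].
have nbr x : x != u -> exists2 w, e x w & forall z, e x z -> z = w.
  move=> xu; have: leaf e x by apply: negbFE; rewrite leafE (negbTE xu).
  case/cards1P=> w /setP nE; exists w; first by have := nE w; rewrite !inE eqxx.
  by move=> z xz; have := nE z; rewrite !inE xz => /esym/eqP.
have leafP v : v != u -> forall y, e v y = (y == u).
  move=> vu; have [w vw wE] := nbr v vu.
  have [wu|wu] := eqVneq w u.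
    by move=> y; apply/idP/eqP => [/wE ->|->] //; rewrite -wu.
  have [z wz zE] := nbr w wu.
  have {}zE x : e w x -> x = v by move/zE->; apply/esym/zE; rewrite sym.
  have cl : closed e [pred x | (x == v) || (x == w)].
    apply: intro_closed => [|x y]; first exact: sym_connect_sym.
    by rewrite !inE => xy /orP[] /eqP xE; move: xy; rewrite xE;
      [move/wE | move/zE] => ->; rewrite eqxx ?orbT.
  have := closed_connect cl (conn v u).
  by rewrite !inE eqxx ![u == _]eq_sym (negbTE vu) (negbTE wu).
move=> x y; have [->|xu] := eqVneq x u; last first.
  by rewrite leafP //=; case: eqP => [->|]; rewrite ?xu ?andbF.
have [->|yu] := eqVneq y u; first by rewrite irr.
by rewrite sym leafP // eqxx.
Qed.

Lemma star_leaf (V : finType) (e : rel V) (u : V) :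
  star e u -> forall v, leaf e v = (v != u).
Proof. by move=> [_ leafE] v; rewrite -leafE negbK. Qed.

(** * The potential of a configuration *)

Section Potential.
Variables (V C : finType) (u : V) (col : V -> C).
Implicit Types (f : V -> C) (g : C -> C) (v : V) (z : C) (S : {set C}).

Notation comp f z := (component (token_graph col f) z).

(** No edge crosses the boundary of [S], so [S] is a union of components; a component is the least
    such set around its colour, which replaces reasoning about paths. *)
Definition colour_closed f S := forall v, (col v \in S) = (f v \in S).

Lemma adjacent_connect_sym f : connect_sym (adjacent (token_graph col f)).
Proof.
by apply: sym_connect_sym => a b; apply: eq_existsb => v; rewrite orbC.
Qed.

Lemma mem_component f z : z \in comp f z.
Proof. by rewrite inE connect0. Qed.

Lemma component_closed f z : colour_closed f (comp f z).
Proof.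
move=> v; rewrite !inE; apply: same_connect_r; first exact: adjacent_connect_sym.
by apply: connect1; apply/existsP; exists v; rewrite !eqxx.
Qed.

Lemma component_min f S z : colour_closed f S -> z \in S -> comp f z \subset S.
Proof.
move=> clS zS; apply/subsetP => y; rewrite inE => zy.
suff cl : closed (adjacent (token_graph col f)) S by rewrite -(closed_connect cl zy).
move=> a b /existsP[v] /=.
by case/orP=> /andP[] /eqP <- /eqP <-; rewrite clS.
Qed.

Lemma component_eqE f y z : (comp f y == comp f z) = (z \in comp f y).
Proof.
apply/eqP/idP => [->|]; first exact: mem_component.
rewrite inE => yz; apply/setP => x; rewrite !inE.
exact: (same_connect (@adjacent_connect_sym f) yz).
Qed.

(** Edges that differ between the two graphs miss the component altogether, so each of the two
    components is closed in the other graph. *)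
Lemma component_agree f (f2 : V -> C) z :
  (forall v, f v != f2 v -> (col v \notin comp f z) && (f2 v \notin comp f z)) ->
  comp f z = comp f2 z.
Proof.
move=> agr; apply/eqP; rewrite eqEsubset andbC.
have sub : comp f2 z \subset comp f z.
  apply: component_min (mem_component f z) => v.
  have [<-|/agr /andP[/negbTE -> /negbTE ->] //] := eqVneq (f v) (f2 v).
  exact: component_closed.
rewrite sub; apply: component_min (mem_component f2 z) => v.
have [->|/agr /andP[cv _]] := eqVneq (f v) (f2 v); first exact: component_closed.
have fv : f v \notin comp f z by rewrite -component_closed.
by rewrite !(contraNF (subsetP sub _)).
Qed.

Lemma component_loops f z : (forall v, f v = col v) -> comp f z = [set z].
Proof.
move=> fE; apply/eqP; rewrite eqEsubset sub1set mem_component andbT.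
by apply: component_min; [move=> v; rewrite fE | rewrite inE].
Qed.

Definition foreign_components f : {set {set C}} :=
  [set S in components (token_graph col f) |
     nontrivial S && (S != comp f (col u))].

Lemma foreign_componentP f S :
  reflect (exists z, [/\ S = comp f z, 1 < #|S| & col u \notin S])
          (S \in foreign_components f).
Proof.
rewrite inE; apply: (iffP and3P) => [[/imsetP[z _ ->]]|[z [-> z1 zu]]].
  by rewrite component_eqE => z1 zu; exists z.
by split=> //; [exact: imset_f | rewrite component_eqE].
Qed.

Definition misplaced f : {set V} := [set v | (v != u) && (col v != f v)].

Definition potential f := #|misplaced f| + kappa col f u.

Lemma kappaE f : kappa col f u = #|foreign_components f|. Proof. by []. Qed.

Lemma potential_solved f : f =1 col -> potential f = 0.
Proof.
move=> fE; apply/eqP; rewrite addn_eq0 kappaE !cards_eq0 -!subset0.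
apply/andP; split; apply/subsetP => x.
  by rewrite inE fE eqxx andbF.
by case/foreign_componentP => z []; rewrite component_loops // => ->; rewrite cards1.
Qed.

(** Every non-trivial component contains the colour of some vertex. The bound is independent of the
    number of colours, as the running time and the memory layout require. *)
Lemma potential_bound f : potential f <= #|V|.*2.
Proof.
rewrite -addnn leq_add ?max_card // kappaE.
rewrite -cardsT; apply: leq_trans (leq_imset_card (fun v => comp f (col v)) _).
apply: subset_leq_card; apply/subsetP => S /foreign_componentP[z [-> z1 _]].
have [v vz|no] := pickP (fun v => col v \in comp f z).
  by apply/imsetP; exists v => //; apply/eqP; rewrite component_eqE.
suff: comp f z \subset [set z] by move/subset_leq_card; rewrite cards1 leqNgt z1.
apply: component_min; last exact: set11.
have nocol v x : x \in comp f z -> (col v == x = false) * (f v == x = false).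
  move=> xz; split; apply: contraFF (no v) => /eqP; first by move=> ->.
  by move=> fx; rewrite component_closed fx.
by move=> v; rewrite !inE !nocol ?mem_component.
Qed.

(** * Effect of one swap, for the lower bound *)

Section Swap.
Variables (f : V -> C) (v : V).
Hypothesis vu : v != u.
Local Notation f' := (swap f (u, v)).

Lemma swap_center : f' u = f v. Proof. by rewrite /swap /= tpermL. Qed.
Lemma swap_leaf : f' v = f u. Proof. by rewrite /swap /= tpermR. Qed.

Lemma swap_other w : w != u -> w != v -> f' w = f w.
Proof. by move=> wu wv; rewrite /swap /= tpermD // eq_sym. Qed.

Lemma swap_neq w : f w != f' w -> (w == u) || (w == v).
Proof.
by apply: contraR; rewrite negb_or => /andP[wu wv]; rewrite swap_other.
Qed.

Lemma component_swap z :
  col u \notin comp f z -> col v \notin comp f z -> comp f z = comp f' z.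
Proof.
move=> cu cv; apply: component_agree => w /swap_neq /orP[] /eqP ->.
  by rewrite cu swap_center -component_closed.
by rewrite cv swap_leaf -component_closed.
Qed.

Lemma component_swapV z :
  col u \notin comp f' z -> col v \notin comp f' z -> comp f z = comp f' z.
Proof.
move=> cu cv; apply/esym; apply: component_agree => w; rewrite eq_sym.
move=> /swap_neq /orP[] /eqP ->.
  by rewrite cu -swap_leaf -component_closed.
by rewrite cv -swap_center -component_closed.
Qed.

Lemma misplaced_swap : misplaced f :\ v = misplaced f' :\ v.
Proof.
apply/setP => w; rewrite !inE; have [//|wv] := eqVneq w v.
by have [//|wu] := eqVneq w u; rewrite swap_other.
Qed.

(** By [component_swap], the only foreign component that can be lost is that of [col v]. *)
Lemma kappa_swap_ge :
  kappa col f u <= kappa col f' u + (col v \notin comp f (col u)).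
Proof.
rewrite !kappaE (cardsD1 (comp f (col v))) addnC leq_add //.
  apply: subset_leq_card; apply/subsetP => S /setD1P[Sv].
  case/foreign_componentP => z [SE z1 zu]; apply/foreign_componentP; exists z.
  by split=> //; rewrite SE -component_swap -?SE // SE -component_eqE -SE.
case: foreign_componentP => // -[z [_ _]]; rewrite -!component_eqE eq_sym.
by move=> ->.
Qed.

(** The two summands cannot both drop. If a foreign component is lost, [col v] is not joined to the
    centre's colour but [f u] is, so [v] is misplaced after the swap. *)
Lemma potential_swap_ge : potential f <= (potential f').+1.
Proof.
rewrite /potential (cardsD1 v) (cardsD1 v (misplaced f')) misplaced_swap.
have := kappa_swap_ge; case: (boolP (col v \in _)) => cv /=.
  by case: (v \in misplaced f); lia.
have -> : v \in misplaced f'.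
  rewrite inE vu swap_leaf; apply: contraNneq cv => ->.
  by rewrite -component_closed mem_component.
by case: (v \in misplaced f); lia.
Qed.

End Swap.

(** * Balance and the greedy choice of a leaf *)

Lemma balanced_card f S :
  balanced col f -> #|[set v | f v \in S]| = #|[set v | col v \in S]|.
Proof.
move=> bal; suff cardE (h : V -> C) :
    #|[set v | h v \in S]| = \sum_(c in S) #|[set v | h v == c]|.
  by rewrite !cardE; apply: eq_bigr => c _; apply: bal.
rewrite -sum1_card (partition_big h (mem S)) => [|v]; last by rewrite inE.
apply: eq_bigr => c cS; rewrite -sum1_card; apply: eq_bigl => v; rewrite !inE.
by case: eqP => [->|]; rewrite ?andbF ?andbT.
Qed.

(** In a balanced graph as many edges enter a set as leave it, so a set that no edge leaves is not
    entered either. *)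
Lemma balanced_closed f S :
  balanced col f -> (forall v, col v \in S -> f v \in S) -> colour_closed f S.
Proof.
move=> bal sub.
have le : [set v | col v \in S] \subset [set v | f v \in S].
  by apply/subsetP => v; rewrite !inE; apply: sub.
have := subset_leqif_cards le; rewrite balanced_card // => /leqifP.
by case: eqP => [/setP eqS _ v|_]; [have := eqS v; rewrite !inE | rewrite ltnn].
Qed.

Lemma balanced_swap f xy : balanced col f -> balanced col (swap f xy).
Proof.
move=> bal c; rewrite -bal -(card_imset _ (@perm_inj _ (tperm xy.1 xy.2))).
congr #|pred_of_set _|; apply/setP => v; rewrite inE; apply/imsetP/idP.
  by case=> w; rewrite inE => /eqP <- ->.
by move=> fv; exists (tperm xy.1 xy.2 v); rewrite ?tpermK // inE /swap tpermK.
Qed.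

Definition rest_closed f S :=
  forall v, v != u -> col v != f u -> (col v \in S) = (f v \in S).

(* [g] labels the components of the graph left after deleting the edge of the *)
(* centre and all edges leaving the colour of the token on the centre.        *)
Definition labelling f g :=
  (forall v, v != u -> col v != f u -> g (col v) = g (f v)) /\
  (forall S, rest_closed f S -> forall a b, g a = g b -> (a \in S) = (b \in S)).

(** Value 1 marks a leaf for [potential_swap_join], usable only when no leaf has value 2 or 3.
    Values 2 and 3 mark leaves for [potential_swap_follow]; 3 is always safe, 2 is safe when it is
    the maximum. *)
Definition priority f g v :=
  if (v == u) || (col v == f v) then 0
  else if col v != f u then 1
  else if g (f v) != g (col u) then 3 else 2.

(** No edge leaves [f u] for another colour, so by balance none arrives from another; the edge of
    the centre ends at [f u] and hence starts there. *)
Lemma center_closed f :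
  balanced col f -> (forall v, v != u -> col v = f u -> f v = f u) ->
  f u = col u /\ colour_closed f [set f u].
Proof.
move=> bal fix_u; have cl : colour_closed f [set f u].
  apply: balanced_closed => // v; rewrite !inE => /eqP cv.
  by have [->//|vu] := eqVneq v u; rewrite fix_u.
by split=> //; have := cl u; rewrite !inE eqxx => /eqP.
Qed.

Lemma priority0_solved f g :
  balanced col f -> (forall v, priority f g v = 0) -> f =1 col.
Proof.
move=> bal pr0; have loop v : v != u -> f v = col v.
  move=> vu; have := pr0 v; rewrite /priority (negbTE vu) /=.
  by case: eqP => // _; do 2?case: ifP.
move=> v; have [->|/loop//] := eqVneq v u.
by have [] := center_closed bal (fun v vu cv => etrans (loop v vu) cv).
Qed.

Lemma potential_swap_join f v :
  balanced col f -> v != u -> col v != f v ->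
  (forall w, w != u -> col w = f u -> f w = f u) ->
  potential (swap f (u, v)) < potential f.
Proof.
move=> bal vu cv fix_u; have [fu cl] := center_closed bal fix_u.
have compu : comp f (col u) \subset [set col u].
  by apply: component_min; rewrite -fu ?set11.
have cvu : col v != col u.
  by apply: contra_neq cv => cvu; rewrite fix_u // cvu.
have mem_fv : f v \in comp f (col v) by rewrite -component_closed mem_component.
have uv : col u \notin comp f (col v).
  apply: contra cvu; rewrite -component_eqE => /eqP compE.
  by rewrite -in_set1 (subsetP compu) // -compE mem_component.
have misp : #|misplaced (swap f (u, v))| <= #|misplaced f|.
  rewrite (cardsD1 v (misplaced f)) (cardsD1 v (misplaced (swap _ _))).
  by rewrite -misplaced_swap [v \in misplaced f]inE vu cv leq_add2r leq_b1.
rewrite /potential -addnS leq_add // !kappaE.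
rewrite (cardsD1 (comp f (col v)) (foreign_components f)).
have -> : comp f (col v) \in foreign_components f.
  apply/foreign_componentP; exists (col v); split=> //.
  by apply/card_gt1P; exists (col v), (f v); rewrite mem_component mem_fv.
rewrite add1n ltnS; apply: subset_leq_card; apply/subsetP => S.
case/foreign_componentP => z [SE z1 zu].
(* After the swap the edge of [v] runs from [col v] to [col u], so a foreign component avoids
   both. *)
have vz : col v \notin S by rewrite SE component_closed swap_leaf fu -SE.
have fS : comp f z = S by rewrite SE (@component_swapV f v) -?SE.
apply/setD1P; split; last by apply/foreign_componentP; exists z; rewrite fS.
by apply: contraNneq vz => ->; apply: mem_component.
Qed.

(** The leaf [v] becomes correct. A new foreign component would have to contain [col v], and the
    last hypothesis makes such a component trivial. *)
Lemma potential_swap_follow f v :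
  v != u -> col v = f u -> f v != col v ->
  (forall z, let S := comp (swap f (u, v)) z in
     col v \in S -> col u \notin S -> #|S| <= 1) ->
  potential (swap f (u, v)) < potential f.
Proof.
move=> vu cv fv isol; rewrite /potential -addSn leq_add //.
  rewrite (cardsD1 v) -misplaced_swap // (cardsD1 v (misplaced f)) !inE vu swap_leaf.
  by rewrite cv eqxx -cv eq_sym fv.
apply: subset_leq_card; apply/subsetP => S /foreign_componentP[z [SE z1 zu]].
have vz : col v \notin S by apply: contraTN z1 => vz; rewrite -leqNgt SE isol -?SE.
apply/foreign_componentP; exists z; split=> //.
by rewrite SE (@component_swapV f v) -?SE.
Qed.

Lemma potential_swap_greedy f g v :
  balanced col f -> labelling f g ->
  (forall w, priority f g w <= priority f g v) -> 0 < priority f g v ->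
  potential (swap f (u, v)) < potential f.
Proof.
move=> bal [labE lab_min] vmax; rewrite {1}/priority.
case: eqVneq => //= vu; case: eqVneq => //= cv _.
have [cvu|cvu] := eqVneq (col v) (f u); last first.
  apply: potential_swap_join => // w wu cw.
  have := vmax w; rewrite /priority (negbTE vu) (negbTE wu) (negbTE cv) cvu cw eqxx /=.
  by case: eqP => //; case: ifP.
apply: potential_swap_follow => //; first by rewrite eq_sym.
(* Suppose that [S], the new component of [f u], misses [col u]. It survives the deletions, hence is
   a union of label classes, and it misses [f v], now the token of the centre. *)
move=> z; set f' := swap f (u, v); move=> S vS uS.
have clS : colour_closed f' S by apply: component_closed.
have fvS : f v \notin S by rewrite -swap_center // -clS.
have uv : col u != f u by rewrite -cvu; apply: contraNneq uS => ->.
have restS : rest_closed f S.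
  move=> w wu cw; rewrite clS /f' swap_other //.
  by apply: contra_neq cw => ->.
have [gv|gv] := eqVneq (g (f v)) (g (col u)); last first.
  (* Priority 3: the label class of [f v] avoids [col u]. If it also avoided [col v], no edge would
     leave it, so by balance the edge of [v] could not enter it. Hence [col v] and [f v] share a
     label, and [f v] lies in [S]. *)
  suff gfv : g (f v) = g (col v) by rewrite (lab_min S restS _ _ gfv) vS in fvS.
  have clK : col v \notin [set c | g c == g (f v)] ->
      colour_closed f [set c | g c == g (f v)].
    rewrite inE => gcv; apply: balanced_closed => // w; rewrite !inE.
    have [->|wu] := eqVneq w u; first by rewrite eq_sym (negbTE gv).
    have [->|cw] := eqVneq (col w) (f u); first by rewrite -cvu (negbTE gcv).
    by rewrite labE.
  apply/esym/eqP; rewrite -[_ == _](in_set (fun c => g c == g (f v))).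
  by apply/negPn/negP => /[dup] /clK -> ; rewrite inE eqxx.
(* Priority 2 is the maximum: any other misplaced leaf of colour [f u] would carry a token labelled
   like [col u], forcing [col u] into [S]. So after the swap only loops leave [col v], and [S] is a
   singleton by balance. *)
have only_v w : w != u -> w != v -> col w = f u -> f w = f u.
  move=> wu wv cw; have fwS : f w \in S by rewrite -(@swap_other f v) // -clS cw -cvu.
  have := vmax w; rewrite /priority (negbTE vu) (negbTE wu) (negbTE cv) cvu cw eqxx gv eqxx /=.
  case: eqP => // _; case: eqP => // gw _.
  by rewrite (lab_min S restS _ _ gw) (negbTE uS) in fwS.
have cl1 : colour_closed f' [set col v].
  apply: balanced_closed (balanced_swap _ bal) _ => w; rewrite !inE => /eqP cw.
  have [wv|wv] := eqVneq w v; first by rewrite wv /f' swap_leaf cvu.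
  have wu : w != u by apply: contra_neq uv => wu; rewrite -cvu -cw wu.
  by rewrite /f' swap_other // only_v ?cvu // cw.
rewrite -(cards1 (col v)) subset_leq_card //.
suff -> : S = comp f' (col v) by apply: component_min; rewrite ?set11.
by apply/eqP; rewrite component_eqE.
Qed.

Lemma potential_le_size (e : rel V) f s :
  (forall x y, e x y = (x != y) && ((x == u) || (y == u))) ->
  solves e col f s -> potential f <= size s.
Proof.
move=> eE; elim: s f => [|[x y] s IHs] f [/= es fs]; first by rewrite potential_solved.
case/andP: es; rewrite eE => /andP[xy xyu] es.
apply: (@leq_trans (potential (swap f (x, y))).+1); last exact: IHs (conj es fs).
case/orP: xyu xy => /eqP -> xy; first by rewrite potential_swap_ge // eq_sym.
by have := potential_swap_ge f xy; rewrite /swap /= tpermC.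
Qed.

Lemma potentialE (e : rel V) f :
  star e u -> (#|V| - 1 - lambda e col f) + kappa col f u = potential f.
Proof.
move=> starE; congr (_ + _); rewrite -(cardsT V) (cardsD1 u) in_setT addKn.
rewrite -(cardsID [set v | col v == f v] (setT :\ u)).
have -> : ([set: V] :\ u) :&: [set v | col v == f v] =
    [set v | leaf e v && is_loop (token_graph col f) v].
  by apply/setP => v; rewrite !inE (star_leaf starE) andbT.
by rewrite addKn; apply: eq_card => v; rewrite !inE andbT andbC.
Qed.

End Potential.

(** * Reasoning about machine programs *)

Import Defs.

(** A total-correctness triple with a time bound. *)
Definition runs (p : prog) (st : state) (T : nat) (Q : state -> Prop) :=
  exists t st', [/\ exec p st t st', t <= T & Q st'].

Lemma runs_weaken p st T T' (Q Q' : state -> Prop) :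
  runs p st T Q -> T <= T' -> (forall st', Q st' -> Q' st') -> runs p st T' Q'.
Proof.
move=> [t [st' [ex tT q]]] TT QQ; exists t, st'.
by split=> //; [apply: leq_trans TT | apply: QQ].
Qed.

Lemma runs_seq p q st T1 T2 (Q : state -> Prop) :
  runs p st T1 (fun st1 => runs q st1 T2 Q) -> runs (Seq p q) st (T1 + T2) Q.
Proof.
move=> [t1 [st1 [ex1 le1 [t2 [st2 [ex2 le2 q2]]]]]]; exists (t1 + t2), st2.
by split=> //; [apply: ExecSeq ex1 ex2 | apply: leq_add].
Qed.

Lemma runs_if a p q st T1 T2 (Q : state -> Prop) :
  (eval st a != 0 -> runs p st T1 Q) -> (eval st a = 0 -> runs q st T2 Q) ->
  runs (If a p q) st ((expr_cost a).+1 + (T1 + T2)) Q.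
Proof.
move=> yes no; have [a0|a0] := eqVneq (eval st a) 0.
  have [t [st' [ex le q']]] := no a0; exists ((expr_cost a).+1 + t), st'.
  by split=> //; [apply: ExecIfFalse | lia].
have [t [st' [ex le q']]] := yes a0; exists ((expr_cost a).+1 + t), st'.
by split=> //; [apply: ExecIfTrue | lia].
Qed.

Fixpoint straight (p : prog) : bool :=
  match p with
  | Seq p q | If _ p q => straight p && straight q
  | While _ _ => false
  | _ => true
  end.

Fixpoint interp (p : prog) (st : state) : state :=
  match p with
  | Assign r a => State (update (regs st) r (eval st a)) (mem st)
  | Store a b => State (regs st) (update (mem st) (eval st a) (eval st b))
  | Seq p q => interp q (interp p st)
  | If a p q => if eval st a == 0 then interp q st else interp p st
  | _ => st
  end.

(** A conditional is charged for both branches, which gives an upper bound independent of the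
    state. *)
Fixpoint cost (p : prog) : nat :=
  match p with
  | Assign _ a => (expr_cost a).+1
  | Store a b => (expr_cost a + expr_cost b).+1
  | Seq p q => cost p + cost q
  | If a p q => (expr_cost a).+1 + (cost p + cost q)
  | _ => 1
  end.

Lemma runs_straight p st (Q : state -> Prop) :
  straight p -> Q (interp p st) -> runs p st (cost p) Q.
Proof.
move=> sp q; suff: runs p st (cost p) (fun st' => st' = interp p st).
  by move/runs_weaken; apply=> // st' ->.
elim: p sp st {q} => //=.
- by move=> _ st; exists 1, st; split=> //; constructor.
- by move=> r a _ st; do 2!eexists; split; first by constructor.
- by move=> a b _ st; do 2!eexists; split; first by constructor.
- move=> p IHp q IHq /andP[sp sq] st; apply: runs_seq.
  by apply: runs_weaken (IHp sp st) _ _ => // _ ->; apply: IHq.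
- move=> a p IHp q IHq /andP[sp sq] st; apply: runs_if => [/negbTE ->|->] /=.
    exact: IHp.
  exact: IHq.
Qed.

(* Register 0 holds the number of vertices throughout. *)
Definition For (r : nat) (body : prog) : prog :=
  Seq (Assign r (Const 0))
      (While (Sub (Reg 0) (Reg r))
             (Seq body (Assign r (Add (Reg r) (Const 1))))).

Definition set_reg (st : state) (r x : nat) : state :=
  State (update (regs st) r x) (mem st).

(** Per round, 8 pays for the guard and the increment; 6 pays for the initial assignment and the
    last, failing guard. *)
Lemma runs_for n r body T T' (I : nat -> state -> Prop) (Q : state -> Prop) st :
  (forall i st', I i st' -> regs st' 0 = n /\ regs st' r = i) ->
  I 0 (set_reg st r 0) ->
  (forall i st', i < n -> I i st' ->
     runs body st' T (fun st'' => I i.+1 (set_reg st'' r (regs st'' r).+1))) ->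
  (forall st', I n st' -> Q st') -> n * (T + 8) + 6 <= T' ->
  runs (For r body) st T' Q.
Proof.
move=> Ireg I0 Istep IQ le_T.
apply: runs_weaken (le_T) (fun _ => id).
suff main m i st' : i + m = n -> I i st' ->
    runs (While (Sub (Reg 0) (Reg r)) (Seq body (Assign r (Add (Reg r) (Const 1)))))
         st' (m * (T + 8) + 4) Q.
  have -> : n * (T + 8) + 6 = 2 + (n * (T + 8) + 4) by lia.
  by apply: runs_seq; apply: runs_straight => //; apply: main I0.
elim: m i st' => [|m IHm] i st' im Ii; have [r0 ri] := Ireg _ _ Ii.
  exists 4, st'; split=> //; last by apply: IQ; rewrite -im addn0.
  by apply: (@ExecWhileFalse (Sub _ _)) => /=; rewrite r0 ri; lia.
have [|t1 [st1 [ex1 le1 I1]]] := Istep i st' _ Ii; first by lia.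
have [|t2 [st2 [ex2 le2 Q2]]] := IHm i.+1 _ _ I1; first by lia.
exists (4 + (t1 + 4) + t2), st2; split=> //; last by lia.
apply: (@ExecWhileTrue (Sub _ _) _ _ _ _ (t1 + 4) t2 _ _ ex2).
  by rewrite /= r0 ri; lia.
apply: ExecSeq ex1 _; rewrite /set_reg -[(regs st1 r).+1]addn1.
exact: (@ExecAssign st1 r (Add (Reg r) (Const 1))).
Qed.

Lemma runs_for_straight n r body T (I : nat -> state -> Prop) (Q : state -> Prop) st :
  straight body ->
  (forall i st', I i st' -> regs st' 0 = n /\ regs st' r = i) ->
  I 0 (set_reg st r 0) ->
  (forall i st', i < n -> I i st' ->
     let st'' := interp body st' in I i.+1 (set_reg st'' r (regs st'' r).+1)) ->
  (forall st', I n st' -> Q st') -> n * (cost body + 8) + 6 <= T ->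
  runs (For r body) st T Q.
Proof.
move=> sb Ireg I0 Istep IQ; apply: runs_for Ireg I0 _ IQ => i st' lt_in Ii.
by apply: runs_straight => //; apply: Istep.
Qed.

(** * The greedy program *)

(* Registers: 0 number of vertices, 1 centre, 2-5 base addresses of the arrays *)
(* of vertex colours, token colours, labels of vertex colours and labels of   *)
(* token colours, 6 length of the output, 7 and 8 loop counters,              *)
(* 11 best priority so far, 12 a vertex attaining it.                          *)
Definition neq (a b : expr) : expr := Add (Sub a b) (Sub b a).
Definition cell (b x : nat) : expr := Deref (Add (Reg b) (Reg x)).
Definition put (b x : nat) (a : expr) : prog := Store (Add (Reg b) (Reg x)) a.

(** The arrays start at 8n, 9n, 10n and 11n, beyond both the input and the output, which never
    exceeds 4n numbers. Register 11 starts nonzero so that the main loop is entered. *)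
Definition setup_regs : prog :=
  Seq (Assign 0 (Deref (Const 1)))
 (Seq (Assign 1 (Deref (Const 2)))
 (Seq (Assign 2 (Add (Reg 0) (Reg 0)))
 (Seq (Assign 2 (Add (Reg 2) (Reg 2)))
 (Seq (Assign 2 (Add (Reg 2) (Reg 2)))
 (Seq (Assign 3 (Add (Reg 2) (Reg 0)))
 (Seq (Assign 4 (Add (Reg 3) (Reg 0)))
 (Seq (Assign 5 (Add (Reg 4) (Reg 0)))
      (Assign 11 (Const 1))))))))).

(** The output will overwrite the input cells, so the colours are moved out of its way. *)
Definition copy_input : prog :=
  For 7 (Seq (put 2 7 (Deref (Add (Const 3) (Reg 7))))
             (put 3 7 (Deref (Add (Const 3) (Add (Reg 0) (Reg 7)))))).

(** Labels are stored per vertex, one for each end of its edge, so that time and space do not depend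
    on the number of colours. *)
Definition init_labels : prog :=
  For 7 (Seq (put 4 7 (cell 2 7)) (put 5 7 (cell 3 7))).

(** Register 9 holds the label to be replaced and register 10 its replacement. *)
Definition relabel_cell (r : nat) : prog :=
  If (neq (cell r 8) (Reg 9)) Skip (put r 8 (Reg 10)).

Definition relabel : prog := For 8 (Seq (relabel_cell 4) (relabel_cell 5)).

Definition merge_labels : prog :=
  For 7 (If (neq (Reg 7) (Reg 1))
            (If (neq (cell 2 7) (cell 3 1))
                (Seq (Seq (Assign 9 (cell 4 7)) (Assign 10 (cell 5 7))) relabel)
                Skip)
            Skip).

Definition compute_priority : prog :=
  Seq (Assign 13 (Const 0))
      (If (neq (Reg 7) (Reg 1))
          (If (neq (cell 2 7) (cell 3 7))
              (If (neq (cell 2 7) (cell 3 1))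
                  (Assign 13 (Const 1))
                  (If (neq (cell 5 7) (cell 4 1))
                      (Assign 13 (Const 3)) (Assign 13 (Const 2))))
              Skip)
          Skip).

Definition keep_best : prog :=
  If (Sub (Reg 13) (Reg 11)) (Seq (Assign 11 (Reg 13)) (Assign 12 (Reg 7))) Skip.

Definition select_leaf : prog :=
  Seq (Assign 11 (Const 0)) (For 7 (Seq compute_priority keep_best)).

Definition perform_swap : prog :=
  Seq (Store (Add (Reg 6) (Const 1)) (Reg 1))
 (Seq (Store (Add (Reg 6) (Const 2)) (Reg 12))
 (Seq (Assign 6 (Add (Reg 6) (Const 2)))
 (Seq (Assign 13 (cell 3 1))
 (Seq (put 3 1 (cell 3 12))
      (put 3 12 (Reg 13)))))).

Definition greedy_step : prog :=
  Seq init_labels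
 (Seq merge_labels
 (Seq select_leaf
      (If (Reg 11) perform_swap Skip))).

Definition star_swapper : prog :=
  Seq setup_regs
 (Seq copy_input
 (Seq (While (Reg 11) greedy_step)
      (Store (Const 0) (Reg 6)))).

Lemma neq_eval x y : ((x - y) + (y - x) == 0) = (x == y).
Proof. by apply/eqP/eqP; lia. Qed.

Lemma relabel_cellE r st : let st' := interp (relabel_cell r) st in
  regs st' = regs st /\
  forall c, mem st' c =
    if (c == regs st r + regs st 8) && (mem st c == regs st 9)
    then regs st 10 else mem st c.
Proof.
rewrite /= neq_eval; have [mE|mE] := eqVneq; split=> //= c; rewrite /update.
  by case: eqP => //= ->; rewrite mE eqxx.
by case: eqP => //= ->; rewrite (negbTE mE).
Qed.

Ltac decide_eqs := repeat (case: eqP => /= ?; try lia).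

(** * Correctness and running time of the greedy program *)

Section Correctness.
Variables (n k : nat) (u : 'I_n) (col : 'I_n -> 'I_k).
Implicit Types (f : 'I_n -> 'I_k) (g : 'I_k -> 'I_k) (v w : 'I_n).

Record layout f (out : seq nat) (st : state) : Prop := Layout {
  reg_n : regs st 0 = n;
  reg_u : regs st 1 = u;
  reg_col : regs st 2 = 8 * n;
  reg_tok : regs st 3 = 9 * n;
  reg_lcol : regs st 4 = 10 * n;
  reg_ltok : regs st 5 = 11 * n;
  reg_out : regs st 6 = size out;
  mem_col : forall v, mem st (8 * n + v) = col v;
  mem_tok : forall v, mem st (9 * n + v) = f v;
  mem_out : forall i, i < size out -> mem st i.+1 = nth 0 out i;
  out_small : size out < 8 * n }.

Lemma layout_frame f out st st' :
  (forall r, r < 7 -> regs st' r = regs st r) ->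
  (forall a, a < 10 * n -> mem st' a = mem st a) ->
  layout f out st -> layout f out st'.
Proof.
move=> rE mE [? ? ? ? ? ? ? mc mt mo os]; split; rewrite ?rE //.
- by move=> v; rewrite mE ?mc //; have := ltn_ord v; lia.
- by move=> v; rewrite mE ?mt //; have := ltn_ord v; lia.
- by move=> i io; rewrite mE ?mo //; lia.
Qed.

Definition labels g f st :=
  forall v, mem st (10 * n + v) = g (col v) /\ mem st (11 * n + v) = g (f v).

Lemma labels_frame g f st st' :
  (forall a, mem st' a = mem st a) -> labels g f st -> labels g f st'.
Proof. by move=> mE lab v; rewrite !mE; apply: lab. Qed.

Lemma init_labelsP f out st (Q : state -> Prop) :
  layout f out st ->
  (forall st', layout f out st' -> labels id f st' -> Q st') ->
  runs init_labels st (n * 100 + 6) Q.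
Proof.
move=> L LQ.
pose I i st' := [/\ layout f out st', regs st' 7 = i &
  forall v, v < i -> mem st' (10 * n + v) = col v /\ mem st' (11 * n + v) = f v].
apply: (runs_for_straight (n := n) (I := I)) => //.
- by move=> i st' [/reg_n].
- by split=> //; apply: layout_frame L => // -[|[|[|[|[|[|[|]]]]]]].
- move=> i st' lt_in [L' r7 lab].
  have [cE tE] := (mem_col L' (Ordinal lt_in), mem_tok L' (Ordinal lt_in)).
  rewrite /= in cE tE.
  rewrite /= /set_reg /update /= r7.
  rewrite (reg_col L') (reg_tok L') (reg_lcol L') (reg_ltok L').
  split=> //=.
    apply: layout_frame L' => [[|[|[|[|[|[|[|]]]]]]]|a] //= alt.
    by decide_eqs.
  move=> v vi; have [vE|vE] := eqVneq (v : nat) i.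
    have -> : v = Ordinal lt_in by apply: val_inj.
    by split; decide_eqs.
  have [] := lab v; first by lia.
  by split; decide_eqs.
- by move=> st' [L' _ lab]; apply: LQ => // v; apply: lab.
- by rewrite /=; lia.
Qed.

Definition rename (a b : 'I_k) g : 'I_k -> 'I_k :=
  fun z => if g z == a then b else g z.

Lemma relabelP f out g st (a b : 'I_k) j (Q : state -> Prop) :
  layout f out st -> labels g f st ->
  regs st 7 = j -> regs st 9 = a -> regs st 10 = b ->
  (forall st', layout f out st' -> labels (rename a b g) f st' ->
     regs st' 7 = j -> Q st') ->
  runs relabel st (n * 100 + 6) Q.
Proof.
move=> L lab r7 r9 r10 LQ.
pose I i st' := [/\ layout f out st', regs st' 8 = i,
  [/\ regs st' 7 = j, regs st' 9 = a & regs st' 10 = b] &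
  forall v, let h := if v < i then rename a b g else g in
    mem st' (10 * n + v) = h (col v) /\ mem st' (11 * n + v) = h (f v)].
apply: (runs_for_straight (n := n) (I := I)) => //.
- by move=> i st' [/reg_n].
- by split=> //; apply: layout_frame L => // -[|[|[|[|[|[|[|]]]]]]].
- move=> i st' lt_in [L' r8 [r7' r9' r10'] lab'].
  move=> st2; pose st1 := interp (relabel_cell 4) st'.
  have := relabel_cellE 5 st1; rewrite -[interp (relabel_cell 5) st1]/st2.
  have := relabel_cellE 4 st'; rewrite -/st1; move: st1 st2 => st1 st2 [].
  rewrite (reg_lcol L') r8 r9' r10' => rE1 mE1; rewrite rE1 => -[].
  rewrite (reg_ltok L') r8 r9' r10' => rE2 mE2.
  have mE c : c <> 10 * n + i -> c <> 11 * n + i -> mem st2 c = mem st' c.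
    by move=> c4 c5; rewrite mE2 mE1; decide_eqs.
  split; rewrite /= ?rE2 /update //= ?r8 //.
    apply: layout_frame L' => [[|[|[|[|[|[|[|]]]]]]]|c] //= clt; rewrite ?rE2 //.
    by rewrite /= mE //; lia.
  move=> v; have [vE|vE] := eqVneq (v : nat) i.
    have := lab' v; rewrite vE ltnn ltnSn /= => -[l4 l5].
    rewrite !mE2 !mE1 !eqxx /= l4 l5 /rename /= !(inj_eq val_inj).
    have -> : (11 * n + i == 10 * n + i) = false by apply/eqP; lia.
    have -> : (10 * n + i == 11 * n + i) = false by apply/eqP; lia.
    by rewrite /= ?(inj_eq val_inj); split; case: ifP.
  have v_lt := ltn_ord v; rewrite !mE; try lia.
  have -> : (v < i.+1) = (v < i) by lia.
  exact: lab'.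
- move=> st' [L' _ [r7' _ _] lab']; apply: LQ => // v.
  by have := lab' v; rewrite ltn_ord.
- by rewrite /=; lia.
Qed.

Lemma merge_labelsP f out st (Q : state -> Prop) :
  layout f out st -> labels id f st ->
  (forall st' g, layout f out st' -> labels g f st' -> labelling u col f g -> Q st') ->
  runs merge_labels st (n * (n * 100 + 200) + 6) Q.
Proof.
move=> L lab LQ.
(* The edges treated so far have equal labels at their ends, and labels are merged only when every
   [rest_closed] set forces it. *)
pose I i st' := exists g, [/\ layout f out st', regs st' 7 = i, labels g f st',
  forall v, v < i -> v != u -> col v != f u -> g (col v) = g (f v) &
  forall S : {set 'I_k}, rest_closed u col f S ->
    forall a b, g a = g b -> (a \in S) = (b \in S)].
apply: (runs_for (n := n) (I := I) (T := n * 100 + 150)).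
- by move=> i st' [g [/reg_n]].
- exists id; split=> //; last by move=> S _ a b ->.
  by apply: layout_frame L => // -[|[|[|[|[|[|[|]]]]]]].
- move=> i st' lt_in [g [L' r7 lab' g_ok g_min]]; set v := Ordinal lt_in.
  have skip : (v == u) || (col v == f u) -> I i.+1 (set_reg st' 7 (regs st' 7).+1).
    move=> vskip; exists g; split=> //=; rewrite ?r7 //.
      by apply: layout_frame L' => // -[|[|[|[|[|[|[|]]]]]]].
    move=> w wi wu cw; have [wE|wE] := eqVneq w v; last first.
      by apply: g_ok => //; move: wE; rewrite -(inj_eq val_inj) /=; lia.
    by move: vskip; rewrite -wE (negbTE wu) (negbTE cw).
  have uE : (regs st' 7 == regs st' 1) = (v == u) by rewrite r7 (reg_u L').
  have cE : (mem st' (8 * n + i) == mem st' (9 * n + u)) = (col v == f u).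
    by rewrite (mem_col L' v) (mem_tok L' u).
  apply: runs_weaken (fun _ => id).
    apply: runs_if => [|/eqP]; rewrite /= neq_eval uE => vu.
      apply: runs_if => [|/eqP]; rewrite /= (reg_col L') (reg_tok L') r7 (reg_u L')
          neq_eval cE => cv.
        apply: runs_seq; apply: runs_straight => //.
        have [] := lab' v; rewrite /= => l4 l5.
        apply: (relabelP (f := f) (out := out) (g := g) (j := i)
                         (a := g (col v)) (b := g (f v))).
        + by apply: layout_frame L' => // -[|[|[|[|[|[|[|]]]]]]].
        + exact: labels_frame lab'.
        + by rewrite /= /update.
        + by rewrite /= /update /= (reg_lcol L') r7.
        + by rewrite /= /update /= (reg_ltok L') r7.
        move=> st2 L2 lab2 r72; exists (rename (g (col v)) (g (f v)) g).
        split=> //=; rewrite ?r72 //.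
        + by apply: layout_frame L2 => // -[|[|[|[|[|[|[|]]]]]]].
        + move=> w wi wu cw; rewrite /rename.
          have [->|wE] := eqVneq w v; first by rewrite eqxx; case: eqP.
          rewrite g_ok //; move: wE; rewrite -(inj_eq val_inj) /=; lia.
        + move=> S clS a b; have gv := clS v vu cv; rewrite /rename.
          case: eqP => [/(g_min S clS) ->|_]; case: eqP => [/(g_min S clS) ->|_] //.
          * by move/(g_min S clS) => <-.
          * by move/(g_min S clS) => ->.
          * exact: g_min.
      by apply: runs_straight => //; apply: skip; rewrite cv orbT.
    by apply: runs_straight => //; apply: skip; rewrite vu.
  by rewrite /=; lia.
- move=> st' [g [L' _ lab' g_ok g_min]]; apply: (LQ st' g) => //; split=> // v.
  exact: g_ok.
- by lia.
Qed.

Lemma compute_priorityE f out g st v :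
  layout f out st -> labels g f st -> regs st 7 = v ->
  let st' := interp compute_priority st in
  [/\ forall r, r != 13 -> regs st' r = regs st r,
      regs st' 13 = priority u col f g v & mem st' = mem st].
Proof.
move=> L lab r7.
have [lv lu] := (lab v, lab u).
rewrite /= /update /= r7 (reg_u L) (reg_col L) (reg_tok L) (reg_lcol L) (reg_ltok L).
rewrite (mem_col L) !(mem_tok L) lv.2 lu.1 !neq_eval.
rewrite !(inj_eq val_inj) /priority.
case: (v == u); [|case: (col v == f v); [|case: (col v == f u);
  [case: (g (f v) == g (col u))|]]]; by split=> //= r /negbTE ->.
Qed.

Lemma select_leafP f out g st (Q : state -> Prop) :
  layout f out st -> labels g f st ->
  (forall st', layout f out st' ->
     (forall v, priority u col f g v <= regs st' 11) ->
     (regs st' 11 = 0 \/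
      exists v, regs st' 12 = v /\ priority u col f g v = regs st' 11) ->
     Q st') ->
  runs select_leaf st (n * 300 + 10) Q.
Proof.
move=> L lab LQ.
pose I i st' := [/\ layout f out st', labels g f st', regs st' 7 = i,
  forall v, v < i -> priority u col f g v <= regs st' 11 &
  regs st' 11 = 0 \/ exists v, regs st' 12 = v /\ priority u col f g v = regs st' 11].
have -> : n * 300 + 10 = 2 + (n * 300 + 8) by lia.
apply: runs_seq; apply: runs_straight => //.
apply: (runs_for_straight (n := n) (I := I)) => //.
- by move=> i st' [/reg_n].
- split=> //; last by left.
  by apply: layout_frame L => // -[|[|[|[|[|[|[|]]]]]]].
- move=> i st' lt_in [L' lab' r7 pmax patt]; set v := Ordinal lt_in.
  have [rE r13 mE] := compute_priorityE (v := v) L' lab' r7.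
  move=> st2; have -> : st2 = interp keep_best (interp compute_priority st') by [].
  move: rE r13 mE {st2}; move: (interp compute_priority st') => st1 rE r13 mE.
  have L1 : layout f out st1.
    by apply: layout_frame L' => [[|[|[|[|[|[|[|]]]]]]]|a] // _; rewrite ?rE ?mE.
  have lab1 : labels g f st1 by apply: labels_frame lab' => a; rewrite mE.
  have [r7' r11] : regs st1 7 = i /\ regs st1 11 = regs st' 11 by rewrite !rE.
  have pmax' m w : regs st1 11 <= m -> priority u col f g v <= m ->
      w < i.+1 -> priority u col f g w <= m.
    move=> le1 le2 wi; have [->//|wE] := eqVneq w v.
    apply: leq_trans le1; rewrite r11; apply: pmax.
    by move: wE; rewrite -(inj_eq val_inj) /=; lia.
  rewrite /= subn_eq0 r13; case: leqP => ple /=; split=> //=.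
  + by apply: layout_frame L1 => // -[|[|[|[|[|[|[|]]]]]]].
  + by rewrite /update /= r7'.
  + by move=> w; apply: pmax'.
  + by rewrite /update /= !rE.
  + by apply: layout_frame L1 => // -[|[|[|[|[|[|[|]]]]]]].
  + by rewrite /update /= r7'.
  + by move=> w; apply: pmax'; rewrite /update /= ?r13 // ltnW.
  + by right; exists v; rewrite /update /= r7' ?r13.
- by move=> st' [L' lab' _ pmax patt]; apply: LQ => // v; apply: pmax.
- by rewrite /=; lia.
Qed.

Lemma perform_swapP f out st v :
  layout f out st -> regs st 12 = v -> v != u -> size out + 2 < 8 * n ->
  let st' := interp perform_swap st in
  layout (swap f (u, v)) (out ++ [:: val u; val v]) st' /\
  regs st' 11 = regs st 11.
Proof.
move=> L r12 vu out_lt; have [u_lt v_lt] := (ltn_ord u, ltn_ord v).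
have [mu mv] := (mem_tok L u, mem_tok L v).
have nuv : (v : nat) <> u by move/val_inj/eqP; apply/negP.
split=> //; case: (L) => R0 R1 R2 R3 R4 R5 R6 mc mt mo os.
split=> //=; rewrite /update /= ?R0 ?R1 ?R2 ?R3 ?R4 ?R5 ?R6 ?r12 ?size_cat //=.
- move=> w; have w_lt := ltn_ord w; rewrite -mc; decide_eqs.
- move=> w; have w_lt := ltn_ord w.
  have [->|wu] := eqVneq w u; first by rewrite swap_center -mv; decide_eqs.
  have [->|wv] := eqVneq w v; first by rewrite swap_leaf -mu; decide_eqs.
  have w1 : (w : nat) <> u by move/val_inj/eqP; apply/negP.
  have w2 : (w : nat) <> v by move/val_inj/eqP; apply/negP.
  by rewrite swap_other // -mt; decide_eqs.
- move=> i i_lt; rewrite nth_cat; case: ltnP => io.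
    by rewrite -mo //; decide_eqs.
  have [->|->] : i = size out \/ i = (size out).+1 by lia.
    by rewrite subnn /=; decide_eqs.
  by rewrite subSnn /=; decide_eqs.
Qed.

Definition step_time := 100 + n * 100 + n * (n * 100 + 200) + n * 300 + 100.

Lemma greedy_stepP f out st :
  layout f out st -> balanced col f -> size out + (potential u col f).*2 < 8 * n ->
  runs greedy_step st step_time (fun st' =>
    [/\ regs st' 11 = 0, f =1 col & layout f out st'] \/
    exists v, [/\ v != u, potential u col (swap f (u, v)) < potential u col f,
      regs st' 11 != 0 & layout (swap f (u, v)) (out ++ [:: val u; val v]) st']).
Proof.
move=> L bal out_lt.
apply: runs_weaken (fun _ => id).
  apply: runs_seq; apply: init_labelsP L _ => {}st L lab.
  apply: runs_seq; apply: merge_labelsP L lab _ => {}st g L lab g_ok.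
  apply: runs_seq; apply: select_leafP L lab _ => {}st L pmax patt.
  apply: runs_straight => //=; have [r11|r11] := eqVneq (regs st 11) 0.
    left; split=> //; apply: (priority0_solved (g := g) (u := u) bal) => v.
    by apply/eqP; rewrite -leqn0 -r11.
  have [/eqP|[v [r12 pv]]] := patt; first by rewrite (negbTE r11).
  right; exists v.
  have vu : v != u.
    by apply: contraNneq r11 => vu; rewrite -pv vu /priority eqxx.
  have lt_pot : potential u col (swap f (u, v)) < potential u col f.
    apply: potential_swap_greedy g_ok _ _ => //; last by rewrite pv lt0n.
    by move=> w; rewrite pv.
  have [] := perform_swapP L r12 vu; first by lia.
  by move=> L' r11'; split=> //; rewrite r11'.
by rewrite /step_time /=; lia.
Qed.

(** Each swap outputs two numbers and lowers the potential, so the space bound persists. The extra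
    round in the time bound is the one that finds the configuration solved. *)
Lemma greedy_loopP (e : rel 'I_n) f out st :
  (forall v, v != u -> e u v) ->
  layout f out st -> balanced col f -> size out + (potential u col f).*2 < 8 * n ->
  regs st 11 != 0 ->
  exists s, [/\ solves e col f s, size s <= potential u col f &
    runs (While (Reg 11) greedy_step) st
      ((potential u col f).+1 * (step_time + 2) + 2)
      (fun st' => exists f', layout f' (out ++ encode_swaps s) st')].
Proof.
move=> eu; have [m] := ubnP (potential u col f).
elim: m f out st => // m IHm f out st lt_m L bal out_lt r11.
have [t1 [st1 [ex1 le1 [[r0 fcol L1]|[v [vu lt_pot r1 L1]]]]]] :=
  greedy_stepP L bal out_lt.
  exists [::]; split=> //; exists (2 + t1 + 2), st1; split.
  - exact: (@ExecWhileTrue (Reg 11) _ _ _ _ _ 2 r11 ex1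
             (@ExecWhileFalse (Reg 11) _ _ r0)).
  - by lia.
  - by exists f; rewrite cats0.
have [||s [[es fs] le_s [t2 [st2 [ex2 le2 [f' L2]]]]]] :=
  IHm _ _ _ _ L1 (balanced_swap _ bal) _ r1.
- by lia.
- by rewrite size_cat /=; lia.
exists ((u, v) :: s); split=> //=.
- by split=> //=; rewrite eu.
- exact: leq_ltn_trans le_s lt_pot.
- exists (2 + t1 + t2), st2; split.
  + exact: (@ExecWhileTrue (Reg 11) _ _ _ _ _ _ r11 ex1 ex2).
  + by nia.
  + by exists f'; rewrite -catA in L2.
Qed.

Lemma encode_instanceE f : let m := mem (init_state (encode_instance u col f)) in
  [/\ m 1 = n, m 2 = u, forall v, m (3 + v) = col v &
      forall v, m (3 + (n + v)) = f v].
Proof.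
split=> //= v; rewrite add0n nth_cat size_map size_enum_ord.
  by rewrite ltn_ord (nth_map u) ?size_enum_ord // nth_ord_enum.
rewrite ltnNge leq_addr /= addKn.
by rewrite (nth_map u) ?size_enum_ord // nth_ord_enum.
Qed.

Lemma size_encode_instance f : size (encode_instance u col f) = 2 * n + 2.
Proof. by rewrite !size_cat !size_map -enumT size_enum_ord /=; lia. Qed.

Lemma copy_inputP f st (Q : state -> Prop) :
  st = interp setup_regs (init_state (encode_instance u col f)) ->
  (forall st', layout f [::] st' -> regs st' 11 != 0 -> Q st') ->
  runs copy_input st (n * 100 + 6) Q.
Proof.
move=> -> LQ; set m := mem (init_state (encode_instance u col f)).
have [m1 m2 mc mt] := encode_instanceE f; have u_lt := ltn_ord u.
pose I i st' := [/\
  [/\ regs st' 0 = n, regs st' 1 = u, regs st' 2 = 8 * n & regs st' 3 = 9 * n],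
  [/\ regs st' 4 = 10 * n, regs st' 5 = 11 * n, regs st' 6 = 0 & regs st' 11 = 1],
  regs st' 7 = i, forall a, a < 8 * n -> mem st' a = m a &
  forall v, v < i -> mem st' (8 * n + v) = col v /\ mem st' (9 * n + v) = f v].
apply: (runs_for_straight (n := n) (I := I)) => //.
- by move=> i st' [[]].
- by rewrite /set_reg /= /update /=; split=> //; split=> //=; lia.
- move=> i st' lt_in [[r0 r1 r2 r3] [r4 r5 r6 r11] r7 mE cp].
  have cE : mem st' (3 + i) = col (Ordinal lt_in).
    by rewrite mE; [exact: (mc (Ordinal lt_in)) | lia].
  have tE : mem st' (3 + (n + i)) = f (Ordinal lt_in).
    by rewrite mE; [exact: (mt (Ordinal lt_in)) | lia].
  rewrite /set_reg /= /update /= r0 r2 r3 r7; split=> //=.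
    by move=> a alt; rewrite -mE //; decide_eqs.
  move=> v vi; have [vE|vE] := eqVneq (v : nat) i.
    have -> : v = Ordinal lt_in by apply: val_inj.
    by split; decide_eqs.
  have [] := cp v; first by lia.
  by split; decide_eqs.
- move=> st' [[r0 r1 r2 r3] [r4 r5 r6 r11] _ _ cp]; apply: LQ; last by rewrite r11.
  by split=> //=; [move=> v; case: (cp v (ltn_ord v)) .. | lia].
- by rewrite /=; lia.
Qed.

Lemma star_swapperP (e : rel 'I_n) f :
  star e u -> balanced col f ->
  exists s, [/\ solves e col f s, size s = potential u col f &
    outputs_within star_swapper (encode_instance u col f) (encode_swaps s)
      (1000 * size (encode_instance u col f) ^ 3)].
Proof.
move=> starE bal; have eE := star_edge starE; have u_lt := ltn_ord u.
have eu v : v != u -> e u v by move=> vu; rewrite eE eqxx eq_sym vu.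
have pot_le : potential u col f <= n.*2.
  by have := potential_bound u col f; rewrite card_ord.
set st0 := init_state (encode_instance u col f).
have [t1 [st1 [ex1 le1 E1]]] :
    runs setup_regs st0 (cost setup_regs) (fun st => st = interp setup_regs st0).
  exact: runs_straight.
have [t2 [st2 [ex2 le2 [L2 r11]]]] : runs copy_input st1 (n * 100 + 6)
    (fun st => layout f [::] st /\ regs st 11 != 0).
  exact: copy_inputP E1 _.
have [|s [sol le_s [t3 [st3 [ex3 le3 [f' L3]]]]]] := greedy_loopP eu L2 bal _ r11.
  by rewrite /=; lia.
exists s; split=> //.
  (* The lower bound, applied to the computed solution itself, turns the inequality into an
     equality. *)
  by apply/eqP; rewrite eqn_leq le_s (potential_le_size eE sol).
exists (t1 + (t2 + (t3 + 3))); eexists; split.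
- apply: (ExecSeq ex1); apply: (ExecSeq ex2); apply: (ExecSeq ex3).
  exact: (@ExecStore st3 (Const 0) (Reg 6)).
- rewrite size_encode_instance; move: le1 le2 le3; rewrite [cost _]/= /step_time.
  set m := potential u col f in pot_le *.
  move=> le1 le2 le3.
  (* At most 2n + 1 rounds, each of quadratic cost. *)
  have le3' : t3 <= n.*2.+1 * (300 * (n + 1) ^ 2) + 2.
    apply: leq_trans le3 _; rewrite leq_add2r leq_mul //.
    by rewrite expnS expn1; nia.
  by rewrite !expnS expn0 in le3' *; nia.
- split=> /=; first by rewrite /update /= (reg_out L3).
  by move=> i i_lt; rewrite /update /= (mem_out L3).
Qed.

End Correctness.

Theorem theorem6p6 :
  (forall (n k : nat) (e : rel 'I_n) (u : 'I_n) (col tok : 'I_n -> 'I_k),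
     star e u -> balanced col tok ->
     min_swaps e col tok ((n - 1 - lambda e col tok) + kappa col tok u))
  /\
  (exists (p : prog) (a b : nat),
     forall (n k : nat) (e : rel 'I_n) (u : 'I_n) (col tok : 'I_n -> 'I_k),
       star e u -> balanced col tok ->
       exists s : seq ('I_n * 'I_n),
         [/\ solves e col tok s,
             size s = (n - 1 - lambda e col tok) + kappa col tok u
           & outputs_within p (encode_instance u col tok) (encode_swaps s)
               (a * size (encode_instance u col tok) ^ b)]).
Proof.
have numE n k e (u : 'I_n) (col tok : 'I_n -> 'I_k) : star e u ->
    (n - 1 - lambda e col tok) + kappa col tok u = potential u col tok.
  by move/(potentialE col tok); rewrite card_ord.
split=> [n k e u col tok starE bal|].
  rewrite numE //; have [s [sol sizeE _]] := star_swapperP starE bal.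
  split; first by exists s.
  by move=> s'; apply: potential_le_size; apply: star_edge.
exists star_swapper, 1000, 3 => n k e u col tok starE bal.
by rewrite numE //; apply: star_swapperP.
Qed.
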